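(* Let $f_1,\ldots,f_M\in\Delta^{J-1}\subset\mathbb{R}^J$ be the identifiable admixture components, and suppose that $\mathcal{K}_M=\mathrm{Conv}(f_1,\ldots,f_M)$ is a simplex in $\Delta^{J-1}$ with set of extreme points $E_M=\mathrm{ex}(\mathcal{K}_M)=\{f_1,\ldots,f_M\}$, so that $M=J$. Let $\pi\in\mathcal{K}_M$, let $\nu_\pi$ be the Choquet measure of $\pi$, let $\zeta$ be the probability distribution on the labels $\{1,\ldots,M\}$ given by $\zeta(\ell)=\nu_\pi(\{f_\ell\})$, and let $F_\zeta$ be its cumulative distribution function. Let $\ell_1,\ell_2,\ldots$ be independent and identically distributed according to $\zeta$ and, for $K\ge 1$ and $x\in\mathbb{R}$, let $$F_K(x)=\frac1K\sum_{j=1}^K\mathbb{I}_{[\ell_j,\infty)}(x)$$ be the empirical cumulative distribution function of $\ell_1,\ldots,\ell_K$. Then $$\sup_{x\in\mathbb{R}}\left|F_K(x)-F_\zeta(x)\right|\xrightarrow[K\to\infty]{a.s.}0.$$ In addition, for any $0<\eta<0.5$, $\sup_{x\in\mathbb{R}}|F_K(x)-F_\zeta(x)|=o\left(\frac{1}{K^\eta}\right)$ almost surely.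
   Context: $\Delta^{J-1}=\{x\in\mathbb{R}^J: x_j\ge 0 \text{ for all } j,\ \sum_{j=1}^J x_j=1\}$ is the unit simplex in $\mathbb{R}^J$. In a finite admixture model $\pi=\sum_{\ell=1}^L\phi_\ell f_\ell$ (with $\phi$ a probability vector and $f_\ell\in\Delta^{J-1}$), the identifiable components are those $f_\ell$ that cannot be written as a convex combination of the others; they are labeled $f_1,\ldots,f_M$, $M\le L$. ''Simplex'' is meant in the classical sense: $\mathcal{K}_M=\{\sum_{\ell=1}^M\xi_\ell f_\ell:\ \sum_{\ell=1}^M\xi_\ell=1,\ \xi_\ell\ge 0\}$ with $M=J$ and $f_1,\ldots,f_M$ affinely independent. The Choquet measure $\nu_\pi$ of $\pi\in\mathcal{K}_M$ is the unique probability measure supported on $E_M$ with $\pi=\sum_{\ell=1}^M f_\ell\,\nu_\pi(\{f_\ell\})$; its values are the identifiable admixture weights. $\mathbb{I}_A$ denotes the indicator function of a set $A$. The labels correspond to an i.i.d. sample $e_k=f_{\ell_k}$ from $\nu_\pi$. *)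

(* Defs.v *)
From HB Require Import structures.
From mathcomp Require Import all_boot all_order all_algebra finmap.
From mathcomp Require Import all_classical all_reals all_analysis.

Set Implicit Arguments.
Unset Strict Implicit.
Unset Printing Implicit Defensive.
Import Order.TTheory GRing.Theory Num.Theory.
Import numFieldNormedType.Exports.
Local Open Scope classical_set_scope.
Local Open Scope ring_scope.

(* The simplex Delta^(n-1) in R^n; its elements also serve as the weight
   vectors of convex combinations of n points. *)
Definition unit_simplex (R : realType) (n : nat) : set 'rV[R]_n :=
  [set x | (forall j, 0 <= x 0 j) /\ \sum_j x 0 j = 1].

Definition convex_hull (R : realType) (n J : nat) (f : 'I_n -> 'rV[R]_J) :
  set 'rV[R]_J := [set \sum_l xi 0 l *: f l | xi in @unit_simplex R n].

(* [f l] is not a convex combination of the other components; these are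
   indexed by labels, so a repeated component is not identifiable. *)
Definition identifiable (R : realType) (L J : nat) (f : 'I_L -> 'rV[R]_J)
    (l : 'I_L) : Prop :=
  ~ exists xi : 'rV[R]_L,
      [/\ unit_simplex xi, xi 0 l = 0 & f l = \sum_k xi 0 k *: f k].

Definition affinely_independent (R : realType) (M J : nat)
    (f : 'I_M -> 'rV[R]_J) : Prop :=
  forall c : 'I_M -> R,
    \sum_l c l = 0 -> \sum_l c l *: f l = 0 -> forall l, c l = 0.

(* The convex hull of f is a simplex in the classical sense, of the full
   dimension J - 1 of Delta^(J-1). *)
Definition spans_simplex (R : realType) (M J : nat)
    (f : 'I_M -> 'rV[R]_J) : Prop :=
  M = J /\ affinely_independent f.

Definition extreme_points (R : realType) (V : lmodType R) (K : set V) :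
  set V :=
  [set x | K x /\ forall (y z : V) (t : R), K y -> K z -> 0 < t < 1 ->
     x = t *: y + (1 - t) *: z -> y = x /\ z = x].

(* R^J with its Borel sigma-algebra. *)
Definition borel_rV (R : realType) (J : nat) :=
  g_sigma_algebraType (@open 'rV[R]_J).

(* When f spans a simplex, exactly one nu satisfies this for each pi in the
   convex hull of f. *)
Definition is_choquet_measure (R : realType) (M J : nat)
    (f : 'I_M -> 'rV[R]_J) (pi : 'rV[R]_J)
    (nu : probability (borel_rV R J) R) : Prop :=
  nu (extreme_points (convex_hull f)) = 1%E /\
  pi = \sum_l fine (nu [set f l]) *: f l.

(* Labels are the naturals 1, ..., M, so the index l : 'I_M of a component
   stands for the label l.+1. *)
Definition label_value (R : realType) (n : nat) : R := n%:R.

Lemma measurable_label_value (R : realType) :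
  measurable_fun [set: nat] (@label_value R).
Proof. by []. Qed.

HB.instance Definition _ (R : realType) :=
  isMeasurableFun.Build _ _ nat R (@label_value R)
    (@measurable_label_value R).

Definition label_cdf (R : realType) (zeta : probability nat R) (x : R) : R :=
  fine (cdf (@label_value R : {RV zeta >-> R}) x).

(* The sample is indexed from 0: [ell j] is the (j+1)-st label. *)
Definition ecdf (R : realType) (ell : nat -> nat) (K : nat) (x : R) : R :=
  K%:R^-1 * \sum_(j < K) \1_(`[label_value R (ell j), +oo[) x.

(* The set is nonempty and, for distribution functions, bounded by 1, so [sup]
   is the true supremum. *)
Definition sup_dist (R : realType) (F G : R -> R) : R :=
  sup [set `|F x - G x| | x in [set: R]].

Definition mutually_independent d d' (T : measurableType d)
    (T' : measurableType d') (R : realType) (P : probability T R)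
    (X : nat -> {RV P >-> T'}) : Prop :=
  forall (I : {fset nat}) (A : nat -> set T'),
    (forall i, measurable (A i)) ->
    P (\bigcap_(i in [set` I]) (X i @^-1` A i)) =
      (\prod_(i <- I) P (X i @^-1` A i))%E.

Definition iid d d' (T : measurableType d) (T' : measurableType d')
    (R : realType) (P : probability T R) (X : nat -> {RV P >-> T'})
    (mu : probability T' R) : Prop :=
  mutually_independent X /\
  forall i (A : set T'), measurable A -> distribution P (X i) A = mu A.

(* Main.v *)
Require Import Defs.
From mathcomp Require Import all_boot all_order all_algebra finmap ring lra.
From mathcomp Require Import all_classical all_reals all_analysis.

Import Order.TTheory GRing.Theory Num.Theory.
Import numFieldNormedType.Exports.
Local Open Scope classical_set_scope.
Local Open Scope ring_scope.

(** The whole argument rests on two facts: the label law is carried by finitely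
    many labels, and each single frequency converges at the claimed rate.

    Since [nu] gives mass 1 to the finite set of extreme points, Boole's
    inequality and [zetaE] show that [zeta] is carried by the labels at most
    [M] ([choquet_label_support]).  Almost surely the sample takes no other
    value, so at a real [x] both distribution functions only see the set of
    labels at most [x], which is one of finitely many subsets of the labels.
    The supremum over [x] is thus bounded by a maximum over finitely many sets
    [B] of the deviation between the empirical frequency of [B] and [zeta B]
    ([sup_dist_le]).

    For one set [A], the number of the first [K] variables lying in [A] is
    binomial, and Chernoff's method bounds the probability that the frequency
    exceeds [mu A] by [delta] by [expR (- K delta^2 / 8)]
    ([hoeffding_upper_deviation]); lower deviations are upper deviations of the
    complement of [A].  With [delta = eps / K^eta] the exponent is a multiple
    of [K^(1 - 2 eta)], which has a positive power because [eta < 1/2], so the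
    bounds are summable ([nneseries_expRN_powR_lty]) and the Borel-Cantelli
    lemma gives the rate almost surely ([ae_frequency_rate]).  Uniform
    convergence to 0 is the case [eta = 1/4]. *)

(** * Exponential moments of Bernoulli sums *)

(** For [u < 1], [1 - u <= expR (- u)] gives [expR u <= 1 / (1 - u)], and the
    geometric series with its tail estimated for [u <= 1/2] gives the
    quadratic. *)
Lemma expR_le_quadratic {R : realType} (u : R) :
  u <= 1 / 2 -> expR u <= 1 + u + 2 * u ^+ 2.
Proof.
move=> u2; have u1 : 0 < 1 - u by lra.
apply: (@le_trans _ _ (1 - u)^-1).
  rewrite -[u in leLHS]opprK expRN lef_pV2 ?posrE ?expR_gt0//.
  exact: expR_ge1Dx.
rewrite -[leLHS]mul1r ler_pdivrMr//.
have -> : (1 + u + 2 * u ^+ 2) * (1 - u) = 1 + u ^+ 2 * (1 - 2 * u) by ring.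
by rewrite lerDl mulr_ge0 ?sqr_ge0//; lra.
Qed.

(** The centred variable takes the value [1 - p] with probability [p] and [- p]
    with probability [1 - p]: in the quadratic bound for the exponential the
    linear terms cancel, which leaves [1 + 2 t^2 p (1 - p)]. *)
Lemma bernoulli_mgf {R : realType} (p t : R) : 0 <= p <= 1 -> 0 <= t <= 1 / 2 ->
  p * expR (t * (1 - p)) + (1 - p) * expR (t * (0 - p)) <= expR (2 * t ^+ 2).
Proof.
move=> /andP[p0 p1] /andP[t0 t1].
have h1 : expR (t * (1 - p)) <= 1 + t * (1 - p) + 2 * (t * (1 - p)) ^+ 2.
  by apply: expR_le_quadratic; nra.
have h2 : expR (t * (0 - p)) <= 1 + t * (0 - p) + 2 * (t * (0 - p)) ^+ 2.
  by apply: expR_le_quadratic; nra.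
apply: (@le_trans _ _ (1 + 2 * t ^+ 2)); last exact: expR_ge1Dx.
have q0 : 0 <= 1 - p by lra.
apply: (le_trans (lerD (ler_wpM2l p0 h1) (ler_wpM2l q0 h2))).
have -> : p * (1 + t * (1 - p) + 2 * (t * (1 - p)) ^+ 2) +
    (1 - p) * (1 + t * (0 - p) + 2 * (t * (0 - p)) ^+ 2) =
    1 + 2 * t ^+ 2 * (p * (1 - p)) by ring.
rewrite lerD2l ler_piMr//; first by rewrite mulr_ge0// sqr_ge0.
by nra.
Qed.

(** Chernoff's bound for a binomial law, written as a weighted sum over the
    outcomes [s] of [K] coin flips.  In this form the moment generating
    function of the sum factors by distributivity, without integrals. *)
Lemma bernoulli_upper_tail {R : realType} (K : nat) (p delta : R) :
  0 <= p <= 1 -> 0 <= delta <= 1 ->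
  \sum_(s : {ffun 'I_K -> bool} | K%:R * delta <= \sum_i ((s i)%:R - p))
    \prod_i (if s i then p else 1 - p) <= expR (- (K%:R * delta ^+ 2 / 8)).
Proof.
move=> p01 /andP[d0 d1]; have /andP[p0 p1] := p01.
(* This t minimises the exponent K (2 t^2 - t delta). *)
pose t := delta / 4.
have t01 : 0 <= t <= 1 / 2 by rewrite /t; apply/andP; split; lra.
have q0 (b : bool) : 0 <= (if b then p else 1 - p) by case: b => //; lra.
have bern0 : 0 <= p * expR (t * (1 - p)) + (1 - p) * expR (t * (0 - p)).
  by rewrite addr_ge0// mulr_ge0 ?expR_ge0//; lra.
pose w (b : bool) := (if b then p else 1 - p) * expR (t * (b%:R - p)).
(* On the outcomes kept, the exponential factor is at least 1. *)
apply: (@le_trans _ _ (expR (- (t * (K%:R * delta))) *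
    \sum_(s : {ffun 'I_K -> bool}) \prod_i w (s i))).
  rewrite mulr_sumr [leLHS]big_mkcond/=; apply: ler_sum => s _.
  have -> : \prod_i w (s i) = (\prod_i (if s i then p else 1 - p)) *
      expR (t * \sum_i ((s i)%:R - p)).
    by rewrite big_split/= mulr_sumr expR_sum.
  have P0 : 0 <= \prod_i (if s i then p else 1 - p) by rewrite prodr_ge0.
  rewrite mulrCA -expRD; case: ifPn => [le_s|_].
    rewrite ler_peMr// -[leLHS]expR0 ler_expR addrC subr_ge0 ler_wpM2l//.
    by case/andP: t01.
  by rewrite mulr_ge0// expR_ge0.
rewrite -(bigA_distr_bigA (fun _ b => w b)) prodr_const card_ord big_bool/=.
apply: (le_trans (ler_wpM2l (expR_ge0 _)
  (lerXn2r K _ _ (bernoulli_mgf p t p01 t01)))).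
- by rewrite nnegrE.
- by rewrite nnegrE expR_ge0.
rewrite -expRM_natl -expRD ler_expR /t le_eqVlt; apply/orP; left.
by apply/eqP; field.
Qed.

Lemma content_bigsetU_le {d} {T : ringOfSetsType d} {R : realFieldType}
    (mu : {content set T -> \bar R}) {I : Type} (r : seq I) (Q : pred I)
    (F : I -> set T) :
  (forall i, measurable (F i)) ->
  (mu (\big[setU/set0]_(i <- r | Q i) F i) <= \sum_(i <- r | Q i) mu (F i))%E.
Proof.
move=> mF; elim: r => [|i r IH]; first by rewrite !big_nil measure0.
rewrite !big_cons; case: ifP => // _.
have mU : measurable (\big[setU/set0]_(j <- r | Q j) F j).
  by apply: bigsetU_measurable.
apply: (le_trans (measureU2 mu (mF i) mU)).
exact: leeD2l.
Qed.

(** * Deviations of frequencies in an i.i.d. sequence *)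

Lemma indep_preimages_ord {d d'} {T : measurableType d}
    {T' : measurableType d'} {R : realType} {P : probability T R}
    (X : nat -> {RV P >-> T'})
    {K : nat} (B : 'I_K -> set T') :
  mutually_independent X -> (forall i, measurable (B i)) ->
  P (\big[setI/setT]_(i < K) (X i @^-1` B i)) =
    (\prod_(i < K) P (X i @^-1` B i))%E.
Proof.
move=> indepX mB.
(* The family B is prolonged by the whole space, as independence is stated for
   families indexed by all the naturals. *)
pose A (n : nat) : set T' := odflt setT (omap B (insub n)).
have AE (i : 'I_K) : A i = B i by rewrite /A valK.
have mA n : measurable (A n) by rewrite /A; case: insubP => //= *; exact: mB.
have := indepX [fset n | n in iota 0 K]%fset A mA.
rewrite bigcap_fset big_imfset//= [X in _ = X -> _]big_imfset//=.
have -> : iota 0 K = index_iota 0 K by rewrite /index_iota subn0.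
rewrite undup_id ?iota_uniq// !big_mkord => indepA.
under [RHS]eq_bigr do rewrite -AE.
rewrite -indepA; congr (P _).
by apply: eq_bigr => i _; rewrite AE.
Qed.

Definition upper_deviation {d d'} {T : measurableType d}
    {T' : measurableType d'} {R : realType} {P : probability T R}
    (X : nat -> {RV P >-> T'})
    (mu : probability T' R) (A : set T') (K : nat) (delta : R) : set T :=
  [set w | K%:R * delta <= \sum_(i < K) (\1_A (X i w) - fine (mu A))].

Section UpperDeviation.
Context d d' (T : measurableType d) (T' : measurableType d')
  (R : realType) (P : probability T R) (X : nat -> {RV P >-> T'})
  (mu : probability T' R) (A : set T').
Hypotheses (iidX : iid X mu) (mA : measurable A).

Let side (b : bool) := if b then A else ~` A.

(** The event that [s] records which of the first [K] variables lie in [A]. *)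
Let pattern {K} (s : {ffun 'I_K -> bool}) :=
  \big[setI/setT]_(i < K) (X i @^-1` side (s i)).

Let p := fine (mu A).

Let measurable_side b : measurable (side b).
Proof. by case: b => //; exact: measurableC. Qed.

Let measurable_pattern K (s : {ffun 'I_K -> bool}) : measurable (pattern s).
Proof.
apply: bigsetI_measurable => i _.
by rewrite -[X in measurable X]setTI; exact: measurable_funPT.
Qed.

Let patternP K (s : {ffun 'I_K -> bool}) w :
  pattern s w <-> forall i : 'I_K, s i = (X i w \in A).
Proof.
rewrite /pattern -bigcap_seq; split=> [sw i|sw i _] /=.
  have := sw i (mem_index_enum i); rewrite /= /side.
  by case: (s i) => [/mem_set->//|Aw]; apply/esym/negbTE; rewrite notin_setE.
by rewrite /side sw; case: ifPn => [/set_mem//|]; rewrite notin_setE.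
Qed.

Let pattern_prob K (s : {ffun 'I_K -> bool}) :
  P (pattern s) = (\prod_i (if s i then p else 1 - p))%:E.
Proof.
rewrite indep_preimages_ord//; last exact: iidX.1.
rewrite -prodEFin; apply: eq_bigr => i _.
rewrite -[LHS]/(distribution P (X i) (side (s i))) iidX.2// /p.
have muA : mu A \is a fin_num by exact: fin_num_measure.
case: (s i) => /=; first by rewrite fineK.
by rewrite probability_setC// EFinB fineK.
Qed.

Let upper_deviationE K delta : upper_deviation X mu A K delta =
  \big[setU/set0]_(s : {ffun 'I_K -> bool} |
    K%:R * delta <= \sum_i ((s i)%:R - p)) pattern s.
Proof.
rewrite -bigcup_pred; apply/seteqP; split=> w /=.
  move=> dev; exists [ffun i : 'I_K => X i w \in A] => /=.
    apply: (le_trans dev); rewrite le_eqVlt; apply/orP; left; apply/eqP.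
    by apply: eq_bigr => i _; rewrite ffunE indicE.
  by apply/patternP => i; rewrite ffunE.
move=> [s dev] /patternP sw; apply: (le_trans dev).
rewrite le_eqVlt; apply/orP; left; apply/eqP.
by apply: eq_bigr => i _; rewrite sw indicE.
Qed.

Lemma measurable_upper_deviation K delta :
  measurable (upper_deviation X mu A K delta).
Proof. by rewrite upper_deviationE; exact: bigsetU_measurable. Qed.

(** The event is a finite union of patterns, and independence makes the
    probability of a pattern the weight that it has in
    [bernoulli_upper_tail]. *)
Lemma hoeffding_upper_deviation K delta : 0 <= delta <= 1 ->
  (P (upper_deviation X mu A K delta)
     <= (expR (- (K%:R * delta ^+ 2 / 8)))%:E)%E.
Proof.
move=> delta01; rewrite upper_deviationE.
apply: (le_trans (content_bigsetU_le P _ _ _ _)) => //.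
rewrite (eq_bigr _ (fun s _ => pattern_prob K s)).
rewrite sumEFin lee_fin; apply: bernoulli_upper_tail => //.
rewrite /p fine_ge0//= -lee_fin fineK ?probability_le1//.
exact: fin_num_measure.
Qed.

End UpperDeviation.

(** * Summability of the tail bounds *)

(** Telescoping: [1 / (n+1)^2 <= 2 / (n+1) - 2 / (n+2)]. *)
Lemma sum_inv_sqr_le {R : realFieldType} (n : nat) :
  \sum_(0 <= i < n) (i.+1%:R ^+ 2)^-1 <= 2 - 2 / n.+1%:R :> R.
Proof.
elim: n => [|n IH]; first by rewrite big_nil divr1 subrr.
rewrite big_nat_recr//=; apply: (le_trans (lerD IH (lexx _))).
have n0 : (0 : R) <= n%:R by rewrite ler0n.
rewrite -[n.+2%:R]natr1 -[n.+1%:R]natr1; set x := n%:R in n0 *.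
have x1 : x + 1 != 0 by lra.
have x2 : x + 1 + 1 != 0 by lra.
rewrite -subr_ge0.
have -> : 2 - 2 / (x + 1 + 1) - (2 - 2 / (x + 1) + ((x + 1) ^+ 2)^-1) =
  x / ((x + 1 + 1) * (x + 1) ^+ 2) by field; rewrite x1 x2.
by apply: divr_ge0 => //; apply: mulr_ge0; [lra|exact: sqr_ge0].
Qed.

(** The exponential series gives [y^(m+1) / (m+1)! <= expR y]; taking [m] with
    [b (m+1) >= 2] turns this into an inverse square bound. *)
Lemma expRN_powR_le_inv_sqr {R : realType} (c b : R) : 0 < c -> 0 < b ->
  exists2 C : R, 0 <= C &
    forall n : nat, expR (- (c * n.+1%:R `^ b)) <= C * (n.+1%:R ^+ 2)^-1.
Proof.
move=> c0 b0; pose m := Num.truncn (2 / b).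
have mb : 2 <= b * m.+1%:R.
  by rewrite mulrC -ler_pdivrMr// ltW// truncnS_gt.
exists (m.+1`!%:R / c ^+ m.+1) => [|n].
  by rewrite divr_ge0// exprn_ge0// ltW.
have K1 : 1 <= n.+1%:R :> R by rewrite ler1n.
have K0 : 0 < n.+1%:R :> R by rewrite ltr0n.
have y0 : 0 < c * n.+1%:R `^ b by rewrite mulr_gt0// powR_gt0.
have f0 : 0 < m.+1`!%:R :> R by rewrite ltr0n fact_gt0.
rewrite expRN -[leRHS]invrK lef_pV2 ?posrE ?expR_gt0//; last first.
  by rewrite invr_gt0 mulr_gt0 ?divr_gt0 ?invr_gt0 ?exprn_gt0.
have := expR_ge1Dxn m (ltW y0).
apply: le_trans.
apply: (@le_trans _ _ ((c * n.+1%:R `^ b) ^+ m.+1 / m.+1`!%:R)); last first.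
  by rewrite lerDr ler01.
have -> : (c * n.+1%:R `^ b) ^+ m.+1 = c ^+ m.+1 * n.+1%:R `^ (b * m.+1%:R).
  by rewrite exprMn powRrM powR_mulrn ?powR_ge0.
have -> : (m.+1`!%:R / c ^+ m.+1 * (n.+1%:R ^+ 2)^-1)^-1 =
    c ^+ m.+1 * n.+1%:R ^+ 2 / m.+1`!%:R.
  by rewrite !invfM !invrK; ring.
rewrite ler_pM2r ?invr_gt0// ler_pM2l ?exprn_gt0//.
by rewrite -[leLHS]powR_mulrn ?(ltW K0)// ler_powR.
Qed.

Lemma nneseries_expRN_powR_lty {R : realType} (c b : R) : 0 < c -> 0 < b ->
  (\sum_(n <oo) (expR (- (c * n.+1%:R `^ b)))%:E < +oo)%E.
Proof.
move=> c0 b0; have [C C0 leC] := expRN_powR_le_inv_sqr _ _ c0 b0.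
apply: (@le_lt_trans _ _ (C * 2)%:E); last exact: ltry.
apply: lime_le.
  by apply: is_cvg_nneseries => n _ _; rewrite lee_fin expR_ge0.
apply: nearW => n; rewrite sumEFin lee_fin.
apply: (@le_trans _ _ (\sum_(0 <= i < n) C * (i.+1%:R ^+ 2)^-1)).
  exact: ler_sum.
rewrite -mulr_sumr ler_wpM2l//; apply: (le_trans (sum_inv_sqr_le n)).
by rewrite gerBl divr_ge0.
Qed.

(** * Almost sure rate for one frequency *)

Section FrequencyRate.
Context d d' (T : measurableType d) (T' : measurableType d')
  (R : realType) (P : probability T R) (X : nat -> {RV P >-> T'})
  (mu : probability T' R).
Hypothesis iidX : iid X mu.

(** Borel-Cantelli applied to the deviations by [eps / K^eta], for [K >= 1].
    The bound [eps <= 1] keeps these deviations in the range covered by the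
    exponential inequality. *)
Lemma ae_upper_rate (A : set T') (eta eps : R) :
  measurable A -> 0 < eta < 1 / 2 -> 0 < eps <= 1 ->
  {ae P, forall w, \forall K \near \oo,
    \sum_(i < K) (\1_A (X i w) - fine (mu A)) < K%:R * (eps / K%:R `^ eta)}.
Proof.
move=> mA /andP[eta0 eta2] /andP[eps0 eps1].
pose F n := upper_deviation X mu A n.+1 (eps / n.+1%:R `^ eta).
have mF n : measurable (F n) by exact: measurable_upper_deviation.
have F0 : P (lim_sup_set F) = 0%E.
  apply: lim_sup_set_cvg0 => //.
  have c0 : 0 < eps ^+ 2 / 8 by rewrite divr_gt0// exprn_gt0.
  have b0 : 0 < 1 - 2 * eta by lra.
  apply: le_lt_trans (nneseries_expRN_powR_lty _ _ c0 b0).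
  apply: lee_nneseries => // n _.
  have K1 : 1 <= n.+1%:R :> R by rewrite ler1n.
  have K0 : 0 < n.+1%:R :> R by rewrite ltr0n.
  have pw1 : 1 <= n.+1%:R `^ eta.
    by rewrite -[leLHS](powRr0 n.+1%:R) ler_powR// ltW.
  have pw0 : 0 < n.+1%:R `^ eta by exact: lt_le_trans pw1.
  apply: (le_trans (hoeffding_upper_deviation _ _ _ _ _ _ _ _ _ iidX mA _ _ _)).
    apply/andP; split; first by rewrite divr_ge0 ?(ltW eps0) ?(ltW pw0).
    by rewrite ler_pdivrMr// mul1r (le_trans eps1).
  rewrite lee_fin ler_expR lerN2 powRD ?gt_eqF ?implybT// powRr1 ?(ltW K0)//.
  rewrite -mulNr [- 2 * eta]mulNr powRN [2 * eta]mulrC powRrM.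
  rewrite powR_mulrn ?(ltW pw0)//.
  by rewrite le_eqVlt; apply/orP; left; apply/eqP; field; rewrite gt_eqF.
exists (lim_sup_set F); split => //.
  apply: bigcap_measurable => // n _; exact: bigcup_measurable.
move=> w /= nw n _; apply: contrapT => nF; apply: nw.
apply: near_inftyS; exists n => // j /= nj; rewrite ltNge; apply/negP => Fj.
by apply: nF; exists j.
Qed.

(** Deviations below [mu A] are deviations of the complement of [A] above its
    own measure.  Restricting [eps] to the inverses of the positive integers
    leaves a countable intersection of almost sure events, so that [eps] can be
    quantified inside. *)
Lemma ae_frequency_rate (A : set T') (eta : R) :
  measurable A -> 0 < eta < 1 / 2 ->
  {ae P, forall w, forall eps : R, 0 < eps -> \forall K \near \oo,
    `|K%:R^-1 * \sum_(i < K) \1_A (X i w) - fine (mu A)| <= eps / K%:R `^ eta}.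
Proof.
move=> mA eta01.
have inv01 (n : nat) : 0 < n.+1%:R^-1 :> R /\ n.+1%:R^-1 <= 1 :> R.
  by split; rewrite ?invr_gt0 ?ltr0n// invf_le1 ?ltr0n// ler1n.
have up (B : set T') : measurable B ->
    {ae P, forall w, forall n : nat, \forall K \near \oo,
      \sum_(i < K) (\1_B (X i w) - fine (mu B)) <
        K%:R * (n.+1%:R^-1 / K%:R `^ eta)}.
  move=> mB; apply: ae_foralln => n; apply: ae_upper_rate => //.
  by have [-> ->] := inv01 n.
have mAC : measurable (~` A) by exact: measurableC.
near=> w => eps eps0.
have upA : forall n : nat, \forall K \near \oo,
    \sum_(i < K) (\1_A (X i w) - fine (mu A)) <
      K%:R * (n.+1%:R^-1 / K%:R `^ eta) by near: w; exact: up.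
have upAC : forall n : nat, \forall K \near \oo,
    \sum_(i < K) (\1_(~` A) (X i w) - fine (mu (~` A))) <
      K%:R * (n.+1%:R^-1 / K%:R `^ eta) by near: w; exact: up.
have [n _ /(_ _ (leqnn n)) /= neps] := near_infty_natSinv_lt (PosNum eps0).
near=> K.
have K0 : 0 < K%:R :> R by rewrite ltr0n; near: K; exact: nbhs_infty_gt.
have fA : \sum_(i < K) (\1_A (X i w) - fine (mu A)) <
  K%:R * (n.+1%:R^-1 / K%:R `^ eta) by near: K.
have fAC : \sum_(i < K) (\1_(~` A) (X i w) - fine (mu (~` A))) <
  K%:R * (n.+1%:R^-1 / K%:R `^ eta) by near: K.
have eAC : \sum_(i < K) (\1_(~` A) (X i w) - fine (mu (~` A))) =
    - \sum_(i < K) (\1_A (X i w) - fine (mu A)).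
  rewrite -sumrN; apply: eq_bigr => i _.
  rewrite probability_setC// fineB//=; last exact: fin_num_measure.
  rewrite !indicE in_setC; case: (_ \in A) => /=; ring.
have -> : K%:R^-1 * \sum_(i < K) \1_A (X i w) - fine (mu A) =
    K%:R^-1 * \sum_(i < K) (\1_A (X i w) - fine (mu A)).
  rewrite sumrB sumr_const card_ord -[X in _ = _ * (_ - X)]mulr_natl.
  rewrite mulrBr mulKf//.
  by rewrite gt_eqF.
rewrite normrM gtr0_norm ?invr_gt0// ler_pdivrMl//.
apply: (@le_trans _ _ (K%:R * (n.+1%:R^-1 / K%:R `^ eta))).
  rewrite ler_norml; apply/andP; split; last exact: ltW.
  by rewrite lerNl -eAC ltW.
by rewrite ler_pM2l// ler_wpM2r ?invr_ge0 ?powR_ge0// ltW.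
Unshelve. all: by end_near. Qed.

End FrequencyRate.

(** * Reduction to finitely many sets of labels *)

Lemma measurable_set1_borel {R : realType} {J : nat} (x : 'rV[R]_J) :
  measurable ([set x] : set (borel_rV R J)).
Proof.
rewrite -[X in measurable X]setCK; apply: measurableC.
apply: sub_gen_smallest; rewrite openC.
apply: accessible_closed_set1; apply: hausdorff_accessible.
exact: norm_hausdorff.
Qed.

(** Boole's inequality bounds the mass 1 of the points by the sum of the
    [nu [set f l]], and this is the [zeta]-mass of the labels [1, ..., M]
    because distinct indices carry distinct labels. *)
Lemma choquet_label_support {R : realType} {J M : nat} (f : 'I_M -> 'rV[R]_J)
    (nu : probability (borel_rV R J) R) (zeta : probability nat R) :
  nu (range f) = 1%E -> (forall l : 'I_M, zeta [set l.+1] = nu [set f l]) ->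
  zeta [set n | (n <= M)%N] = 1%E.
Proof.
move=> nuf zetaE; apply/eqP; rewrite eq_le probability_le1//= -nuf.
have -> : range f = \big[setU/set0]_(l < M) [set f l].
  rewrite -bigcup_seq; apply/seteqP.
  split=> [_ [l _ <-]|_ [l _ ->]]; last by exists l.
  by exists l => //; exact: mem_index_enum.
apply: (le_trans (content_bigsetU_le nu _ _ _ _)).
  by move=> l; exact: measurable_set1_borel.
rewrite (eq_bigr _ (fun l _ => esym (zetaE l))).
rewrite -(measure_bigsetU_ord _ xpredT)//.
  apply: le_measure; rewrite ?inE// -bigcup_seq => _ [l _ ->] /=.
  exact: ltn_ord.
by move=> i j _ _ [n [-> [/ord_inj]]].
Qed.

Definition labels_in {M : nat} (B : {set 'I_M.+1}) : set nat :=
  [set n | exists2 l : 'I_M.+1, l \in B & l = n :> nat].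

(** At [r] both distribution functions are determined by the set [B] of those
    labels, out of [0, ..., M], that are at most [r]; the labels above [M]
    contribute nothing on either side. *)
Lemma sup_dist_le {R : realType} (M K : nat) (zeta : probability nat R)
    (x : nat -> nat) (e : R) :
  zeta [set n | (n <= M)%N] = 1%E -> (forall j, (x j <= M)%N) ->
  (forall B : {set 'I_M.+1},
    `|K%:R^-1 * \sum_(i < K) \1_(labels_in B) (x i) - fine (zeta (labels_in B))|
      <= e) ->
  sup_dist (ecdf x K) (label_cdf zeta) <= e.
Proof.
move=> zetaM xM le_e; apply: ge_sup.
  by exists `|ecdf x K 0 - label_cdf zeta 0|, 0.
move=> _ [r _ <-].
pose B := [set l : 'I_M.+1 | l%:R <= r :> R]%SET.
have inB n : (n <= M)%N -> labels_in B n <-> n%:R <= r.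
  move=> nM; split=> [[l + <-]|nr]; first by rewrite inE.
  by exists (inord n); rewrite ?inE inordK.
suff [-> ->] : ecdf x K r = K%:R^-1 * \sum_(i < K) \1_(labels_in B) (x i) /\
    label_cdf zeta r = fine (zeta (labels_in B)) by exact: le_e.
split.
  rewrite /ecdf; congr (_ * _); apply: eq_bigr => i _; rewrite !indicE.
  congr ((_ : bool)%:R); apply/idP/idP; rewrite !inE /= in_itv/= andbT.
    by move=> xr; apply/inB.
  by move/inB; apply.
rewrite /label_cdf /cdf /distribution /pushforward/=.
have zetaMC : zeta (~` [set n | (n <= M)%N]) = 0%E.
  by rewrite probability_setC// zetaM subee.
set S := _ @^-1` _; congr fine; apply/eqP; rewrite eq_le; apply/andP; split.
  rewrite -[leRHS]adde0 -zetaMC.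
  apply: (le_trans _ (measureU2 zeta _ _)) => //.
  apply: le_measure; rewrite ?inE// => n Sn.
  have [nM|nM] := boolP (n <= M)%N; [left|right; exact/negP].
  by apply/(inB _ nM); move: Sn; rewrite /S /= in_itv.
apply: le_measure; rewrite ?inE// => n nB.
have nM : (n <= M)%N by case: nB => l _ <-; rewrite -ltnS ltn_ord.
by rewrite /S /= in_itv/=; exact/(inB _ nM).
Qed.

Lemma sup_dist_ge0 {R : realType} (F G : R -> R) : 0 <= sup_dist F G.
Proof.
rewrite /sup_dist; set E := (X in sup X).
have [[E0 Eub]|/sup_out->//] := pselect (has_sup E).
by apply: (@le_trans _ _ `|F 0 - G 0|) => //; apply: ub_le_sup => //; exists 0.
Qed.

(** There are finitely many sets [B] of labels, so the rates for the
    individual frequencies hold simultaneously, both outside one null set and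
    from one index on. *)
Lemma ae_sup_dist_rate {R : realType} {d} {Omega : measurableType d}
    {P : probability Omega R} (ell : nat -> {RV P >-> nat}) (M : nat)
    (zeta : probability nat R) (eta : R) :
  zeta [set n | (n <= M)%N] = 1%E -> iid ell zeta -> 0 < eta < 1 / 2 ->
  {ae P, forall w, forall eps : R, 0 < eps -> \forall K \near \oo,
    sup_dist (ecdf (fun j => ell j w) K) (label_cdf zeta) <= eps / K%:R `^ eta}.
Proof.
move=> zetaM iid_ell eta01.
have bounded : {ae P, forall w, forall j, (ell j w <= M)%N}.
  apply: ae_foralln => j; exists (ell j @^-1` (~` [set n | (n <= M)%N])).
  split=> //.
    by rewrite -[X in measurable X]setTI; exact: measurable_funPT.
  rewrite -[LHS]/(distribution P (ell j) (~` [set n | (n <= M)%N])) iid_ell.2//.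
  by rewrite probability_setC// zetaM subee.
have rate : {ae P, forall w, forall (B : {set 'I_M.+1}) (eps : R), 0 < eps ->
    \forall K \near \oo,
    `|K%:R^-1 * \sum_(i < K) \1_(labels_in B) (ell i w) -
      fine (zeta (labels_in B))| <= eps / K%:R `^ eta}.
  by apply: filter_forall => B; exact: ae_frequency_rate.
near=> w => eps eps0.
have rate_w : \forall K \near \oo, forall B : {set 'I_M.+1},
    `|K%:R^-1 * \sum_(i < K) \1_(labels_in B) (ell i w) -
      fine (zeta (labels_in B))| <= eps / K%:R `^ eta.
  apply: filter_forall => B; move: B eps eps0; near: w; exact: rate.
apply: filterS rate_w => K; apply: sup_dist_le => //.
by near: w.
Unshelve. all: by end_near. Qed.

(** * The Glivenko-Cantelli theorem with rate *)

Theorem theorem10 (R : realType) (J L M : nat) (leML : (M <= L)%N)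
  (f : 'I_L -> 'rV[R]_J)
  (f_simplex : forall l, unit_simplex (f l))
  (f_identifiable : forall l : 'I_L, identifiable f l <-> (l < M)%N)
  (fM := fun l : 'I_M => f (widen_ord leML l))
  (K_simplex : spans_simplex fM)
  (K_extreme : extreme_points (convex_hull fM) = range fM)
  (pi : 'rV[R]_J) (pi_K : convex_hull fM pi)
  (nu : probability (borel_rV R J) R) (nu_pi : is_choquet_measure fM pi nu)
  (zeta : probability nat R)
  (zetaE : forall l : 'I_M, zeta [set l.+1] = nu [set fM l])
  (d : measure_display) (Omega : measurableType d) (P : probability Omega R)
  (ell : nat -> {RV P >-> nat}) (ell_iid : iid ell zeta) :
  {ae P, forall w,
     sup_dist (ecdf (fun j => ell j w) K) (label_cdf zeta)
       @[K --> \oo] --> (0 : R)}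
  /\
  forall eta : R, 0 < eta < 1 / 2 ->
    {ae P, forall w,
       (fun K : nat =>
          sup_dist (ecdf (fun j => ell j w) K) (label_cdf zeta) : R^o)
       =o_\oo (fun K : nat => 1 / (K%:R `^ eta) : R^o)}.
Proof.
have zetaM : zeta [set n | (n <= M)%N] = 1%E.
  apply: (choquet_label_support fM nu) => //.
  by rewrite -K_extreme; case: nu_pi.
split=> [|eta eta01].
  have eta01 : 0 < (1 / 4 : R) < 1 / 2 by apply/andP; split; lra.
  apply: filterS (ae_sup_dist_rate ell M zeta (1 / 4) zetaM ell_iid eta01).
  move=> w rate.
  apply/cvgrPdist_le => eps eps0; have rate_eps := rate eps eps0.
  near=> K.
  rewrite sub0r normrN ger0_norm ?sup_dist_ge0//.
  have le_rate : sup_dist (ecdf (fun j => ell j w) K) (label_cdf zeta) <=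
    eps / K%:R `^ (1 / 4) by near: K.
  apply: (le_trans le_rate).
  have K1 : 1 <= K%:R :> R by rewrite ler1n; near: K; exact: nbhs_infty_gt.
  have pow1 : 1 <= K%:R `^ (1 / 4) :> R.
    by rewrite -[leLHS](powRr0 K%:R) ler_powR// ltW//; case/andP: eta01.
  by rewrite ler_pdivrMr ?(lt_le_trans ltr01)// ler_peMr// ltW.
apply: filterS (ae_sup_dist_rate ell M zeta eta zetaM ell_iid eta01) => w rate.
apply/eqoP => eps eps0; apply: filterS (rate eps eps0) => K.
rewrite ger0_norm ?sup_dist_ge0// ger0_norm ?divr_ge0 ?powR_ge0//.
by rewrite mulrA mulr1.
Unshelve. all: by end_near. Qed.
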